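(* Let D-APEP be parameterized by the number of resources and WSP by the number of steps. Then: (1) D-APEP$\langle\mathsf{SoD},(=,1)\rangle =_{\it fpt}$ WSP$(\neq)$; (2) D-APEP$\langle\mathsf{BoD},(=,1)\rangle =_{\it fpt}$ WSP$(=)$; (3) D-APEP$\langle\mathsf{BoD},\mathsf{SoD},(=,1)\rangle =_{\it fpt}$ WSP$(=,\neq)$.
   Context: D-APEP. An instance consists of a finite set $U$ of users, a finite set $R$ of resources, a base authorization relation $A_{\sf Bse}\subseteq U\times R$ with $A_{\sf Bse}(r)\neq\emptyset$ for all $r\in R$, and a set $C$ of constraints. For $A\subseteq U\times R$, $A(r)=\{u\in U:(u,r)\in A\}$. $A$ is authorized if $A\subseteq A_{\sf Bse}$, complete if $A(r)\ne\emptyset$ for all $r\in R$, eligible if it satisfies every $c\in C$, and valid if it is authorized, complete and eligible. The question is whether a valid $A$ exists. Constraints. For $r,r'\in R$ and complete $A$: $(r,r',\leftrightarrow,\exists)$ is satisfied iff $A(r)\cap A(r')\neq\emptyset$; $(r,r',\leftrightarrow,\forall)$ iff $A(r)=A(r')$; $(r,r',\updownarrow,\exists)$ iff $A(r)\ne A(r')$; $(r,r',\updownarrow,\forall)$ iff $A(r)\cap A(r')=\emptyset$. The global constraint $(=,1)$ is satisfied iff $|A(r)|=1$ for all $r\in R$. $\mathsf{BoD}$ is the family of all constraints $(r,r',\leftrightarrow,\exists)$ and $(r,r',\leftrightarrow,\forall)$; $\mathsf{SoD}$ is the family of all constraints $(r,r',\updownarrow,\exists)$ and $(r,r',\updownarrow,\forall)$.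 D-APEP$\langle\mathcal F,(=,1)\rangle$ denotes D-APEP restricted to instances in which $C$ consists of the constraint $(=,1)$ together with constraints from the families listed in $\mathcal F$. WSP. An instance consists of a finite set $U$ of users, a finite set $S$ of steps, an authorization relation $A\subseteq S\times U$, and a set $C$ of constraints. A plan is a function $\pi:S\to U$; it is valid if $(s,\pi(s))\in A$ for all $s\in S$ and all constraints are satisfied. The question is whether a valid plan exists. A constraint $(s,s',\neq)$ is satisfied iff $\pi(s)\ne\pi(s')$; $(s,s',=)$ iff $\pi(s)=\pi(s')$. WSP$(\neq)$, WSP$(=)$, WSP$(=,\neq)$ are the restrictions to instances with only constraints of type $\neq$, only of type $=$, or only of these two types, respectively. Reductions. For parameterized problems $P,Q$, $P\le_{\it fpt}Q$ means there is a polynomial-time algorithm transforming an instance $(I,k)$ of $P$ into an instance $(I',k')$ of $Q$ such that $(I,k)$ is positive iff $(I',k')$ is positive, and $k'\le f(k)$ for some computable function $f$. $P=_{\it fpt}Q$ means $P\le_{\it fpt}Q$ and $Q\le_{\it fpt}P$. *)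

(* Defs.v *)
From HB Require Import structures.
From mathcomp Require Import all_boot.

Set Implicit Arguments.
Unset Strict Implicit.
Unset Printing Implicit Defensive.

Inductive move := MoveLeft | Stay | MoveRight.

(* A two-way infinite tape over the cell contents [option G], where [None] is
   the blank: [tleft] lists the cells to the left of the head, nearest first,
   [tright] those to its right; all cells not listed are blank. *)
Record tape (G : Type) := Tape {
  tleft : seq (option G);
  thead : option G;
  tright : seq (option G) }.

Definition tape_write G (c : option G) (t : tape G) : tape G :=
  Tape (tleft t) c (tright t).

Definition tape_move G (d : move) (t : tape G) : tape G :=
  match d with
  | Stay => t
  | MoveLeft => Tape (behead (tleft t)) (head None (tleft t))
                     (thead t :: tright t)
  | MoveRight => Tape (thead t :: tleft t) (head None (tright t))
                      (behead (tright t))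
  end.

(* A deterministic multi-tape Turing machine. Its input and output alphabet is
   [Sigma]; the tape alphabet consists of
   [Sigma], the extra symbols [work] and the blank. *)
Record machine (Sigma : finType) := Machine {
  extra_tapes : nat;
  work : finType;
  state : finType;
  start : state;
  final : pred state;
  delta : state -> {ffun 'I_extra_tapes.+1 -> option (Sigma + work)} ->
    state * {ffun 'I_extra_tapes.+1 -> option (Sigma + work) * move} }.

Section Run.
Variables (Sigma : finType) (M : machine Sigma).

Definition letter : Type := (Sigma + work M)%type.

Definition config : Type :=
  (state M * {ffun 'I_(extra_tapes M).+1 -> tape letter})%type.

Definition step (c : config) : config :=
  if final c.1 then c else
  let: (q, act) := delta c.1 [ffun i => thead (c.2 i)] in
  (q, [ffun i => tape_move (act i).2 (tape_write (act i).1 (c.2 i))]).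

Definition blank_tape : tape letter := Tape [::] None [::].

Definition input_tape (x : seq Sigma) : tape letter :=
  let s := [seq Some (inl a : letter) | a <- x] in
  Tape [::] (head None s) (behead s).

(* The input is on tape [ord0], with the head on its first letter. *)
Definition init (x : seq Sigma) : config :=
  (start M, [ffun i => if i == ord0 then input_tape x else blank_tape]).

(* The contents of the tape is the word [y], surrounded by blanks; the
   position of the head is irrelevant. *)
Definition tape_holds (t : tape letter) (y : seq Sigma) : Prop :=
  exists i j : nat,
    rev (tleft t) ++ thead t :: tright t =
    nseq i None ++ [seq Some (inl a : letter) | a <- y] ++ nseq j None.

(* Started on [x], the machine halts within [t] steps with [y] on its last
   tape. *)
Definition outputs_within (t : nat) (x y : seq Sigma) : Prop :=
  let c := iter t step (init x) in final c.1 /\ tape_holds (c.2 ord_max) y.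

End Run.

Definition poly_time (Sigma : finType) (X Y : Type)
    (codeX : X -> seq Sigma) (codeY : Y -> seq Sigma) (f : X -> Y) : Prop :=
  exists (M : machine Sigma) (c d : nat), forall x : X,
    exists2 t : nat, t <= c * size (codeX x) ^ d + c &
      outputs_within M t (codeX x) (codeY (f x)).

(* Numbers are written in unary. *)
Definition computable (g : nat -> nat) : Prop :=
  exists M : machine unit, forall n : nat,
    exists t : nat, outputs_within M t (nseq n tt) (nseq (g n) tt).

Inductive sym := Bit of bool | Comma | Semi.

Definition sym_to (a : sym) : bool + bool :=
  match a with Bit b => inl b | Comma => inr false | Semi => inr true end.
Definition sym_of (x : bool + bool) : sym :=
  match x with inl b => Bit b | inr b => if b then Semi else Comma end.
Lemma sym_toK : cancel sym_to sym_of. Proof. by case. Qed.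
HB.instance Definition _ := Finite.copy sym (can_type sym_toK).

(* An instance [(I, k)] is an element [x] of [inst] with [k = param x]; [code x]
   is the word by which it is presented to algorithms. *)
Record problem := Problem {
  inst : Type;
  code : inst -> seq sym;
  param : inst -> nat;
  positive : inst -> Prop }.

Definition restrict (P : problem) (D : inst P -> Prop) : problem :=
  {| inst := {x : inst P | D x};
     code := fun x => code (sval x);
     param := fun x => param (sval x);
     positive := fun x => positive (sval x) |}.

Definition fpt_le (P Q : problem) : Prop :=
  exists f : inst P -> inst Q,
    [/\ poly_time (@code P) (@code Q) f,
        forall x, positive x <-> positive (f x) &
        exists2 g : nat -> nat, computable g &
          forall x, param (f x) <= g (param x)].

Definition fpt_eq (P Q : problem) : Prop := fpt_le P Q /\ fpt_le Q P.

Definition code_nat (n : nat) : seq sym := rcons (nseq n (Bit true)) Semi.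

(* Row by row; the entries are bit strings of a common fixed length, so that
   no separators are needed within a row. *)
Definition code_matrix (m n : nat) (e : 'I_m -> 'I_n -> seq bool) : seq sym :=
  rcons
    (flatten [seq rcons (flatten [seq map Bit (e i j) | j <- enum 'I_n]) Comma
             | i <- enum 'I_m])
    Semi.

Inductive link := Bind | Separate. (* the arrows <-> and updown *)
Inductive quant := Ex | All.

Definition link_to (l : link) : bool := if l is Bind then true else false.
Definition link_of (b : bool) : link := if b then Bind else Separate.
Lemma link_toK : cancel link_to link_of. Proof. by case. Qed.
HB.instance Definition _ := Finite.copy link (can_type link_toK).

Definition quant_to (q : quant) : bool := if q is Ex then true else false.
Definition quant_of (b : bool) : quant := if b then Ex else All.
Lemma quant_toK : cancel quant_to quant_of. Proof. by case. Qed.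
HB.instance Definition _ := Finite.copy quant (can_type quant_toK).

(* [CardOne] is the global constraint (=, 1). *)
Inductive constr (R : Type) :=
  | PairConstr of R & R & link & quant
  | CardOne.
Arguments CardOne {R}.

Definition constr_to R (c : constr R) : option (R * R * link * quant) :=
  if c is PairConstr r r' l q then Some (r, r', l, q) else None.
Definition constr_of R (x : option (R * R * link * quant)) : constr R :=
  if x is Some (r, r', l, q) then PairConstr r r' l q else CardOne.
Lemma constr_toK R : cancel (@constr_to R) (@constr_of R).
Proof. by case. Qed.
HB.instance Definition _ (R : finType) :=
  Finite.copy (constr R) (can_type (@constr_toK R)).

Section Authorization.
Variables U R : finType.
Implicit Types (A : {set U * R}) (C : {set constr R}).

Definition users A (r : R) : {set U} := [set u | (u, r) \in A].

Definition complete A : Prop := forall r : R, users A r != set0.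

Definition satisfies A (c : constr R) : Prop :=
  match c with
  | PairConstr r r' Bind Ex => users A r :&: users A r' != set0
  | PairConstr r r' Bind All => users A r = users A r'
  | PairConstr r r' Separate Ex => users A r <> users A r'
  | PairConstr r r' Separate All => users A r :&: users A r' = set0
  | CardOne => forall r : R, #|users A r| = 1
  end.

Definition authorized (Abse : {set U * R}) A : Prop := A \subset Abse.

Definition eligible C A : Prop := forall c, c \in C -> satisfies A c.

Definition valid (Abse : {set U * R}) C A : Prop :=
  [/\ authorized Abse A, complete A & eligible C A].

End Authorization.

(* As input of an algorithm, a finite set with n elements is {0,...,n-1}. *)
Record dapep_inst := DapepInst {
  nusers : nat;
  nresources : nat;
  base : {set 'I_nusers * 'I_nresources};
  base_complete : forall r : 'I_nresources, users base r != set0;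
  constraints : {set constr 'I_nresources} }.

(* The matrix of constraints has one entry per pair of resources, stating which
   of the four constraints on this pair belong to the instance. The parameter
   occurs in unary in the second block. *)
Definition dapep_code (I : dapep_inst) : seq sym :=
  let C := constraints I in
  code_nat (nusers I) ++ code_nat (nresources I) ++
  code_matrix (fun (r : 'I_(nresources I)) (u : 'I_(nusers I)) =>
    [:: (u, r) \in base I]) ++
  code_matrix (fun r r' : 'I_(nresources I) =>
    [:: PairConstr r r' Bind Ex \in C; PairConstr r r' Bind All \in C;
        PairConstr r r' Separate Ex \in C; PairConstr r r' Separate All \in C])
  ++ [:: Bit (CardOne \in C)].

Definition DAPEP : problem :=
  {| inst := dapep_inst;
     code := dapep_code;
     param := nresources;
     positive := fun I => exists A, valid (base I) (constraints I) A |}.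

Inductive family := BoD | SoD.

Definition in_family (R : Type) (c : constr R) (F : family) : bool :=
  match F, c with
  | BoD, PairConstr _ _ Bind _ => true
  | SoD, PairConstr _ _ Separate _ => true
  | _, _ => false
  end.

(* Usually written D-APEP<Fs, (=,1)>. *)
Definition DAPEP_one (Fs : seq family) : problem :=
  @restrict DAPEP (fun I : dapep_inst =>
    CardOne \in constraints I /\
    forall c, c \in constraints I -> c = CardOne \/ has (in_family c) Fs).

Inductive wsp_type := StepEq | StepNeq.

Definition wsp_type_to (t : wsp_type) : bool := if t is StepEq then true else false.
Definition wsp_type_of (b : bool) : wsp_type := if b then StepEq else StepNeq.
Lemma wsp_type_toK : cancel wsp_type_to wsp_type_of. Proof. by case. Qed.
HB.instance Definition _ := Finite.copy wsp_type (can_type wsp_type_toK).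

Section Plans.
Variables S U : finType.
Implicit Types (p : {ffun S -> U}) (A : {set S * U}) (C : {set S * S * wsp_type}).

Definition plan_satisfies p (c : S * S * wsp_type) : Prop :=
  match c with
  | (s, s', StepEq) => p s = p s'
  | (s, s', StepNeq) => p s <> p s'
  end.

Definition valid_plan A C p : Prop :=
  (forall s : S, (s, p s) \in A) /\ (forall c, c \in C -> plan_satisfies p c).

End Plans.

Record wsp_inst := WspInst {
  wsp_nusers : nat;
  wsp_nsteps : nat;
  wsp_auth : {set 'I_wsp_nsteps * 'I_wsp_nusers};
  wsp_constraints : {set 'I_wsp_nsteps * 'I_wsp_nsteps * wsp_type} }.

Definition wsp_code (I : wsp_inst) : seq sym :=
  let C := wsp_constraints I in
  code_nat (wsp_nusers I) ++ code_nat (wsp_nsteps I) ++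
  code_matrix (fun (s : 'I_(wsp_nsteps I)) (u : 'I_(wsp_nusers I)) =>
    [:: (s, u) \in wsp_auth I]) ++
  code_matrix (fun s s' : 'I_(wsp_nsteps I) =>
    [:: (s, s', StepEq) \in C; (s, s', StepNeq) \in C]).

Definition WSP : problem :=
  {| inst := wsp_inst;
     code := wsp_code;
     param := wsp_nsteps;
     positive := fun I => exists p, valid_plan (wsp_auth I) (wsp_constraints I) p |}.

Definition WSP_only (ts : seq wsp_type) : problem :=
  @restrict WSP (fun I : wsp_inst =>
    forall c, c \in wsp_constraints I -> c.2 \in ts).

(* Main.v *)
(* Under (=, 1) an authorization relation is the graph of a plan, both kinds of
   [Bind] constraints become equality and both kinds of [Separate] constraints
   become inequality of the two assigned users. So the encodings of
   corresponding instances differ only in the matrix of constraints, and both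
   translations are computed by sequential transducers, which a two-tape machine
   simulates in linear time. The one obstacle is that D-APEP requires every
   resource to have an authorized user: the transducer from WSP detects a step
   with an empty row, and then its output is replaced by a fixed negative
   instance with two resources; the parameter is at most doubled since such a
   WSP instance has at least one step. *)

Require Import Defs.
From mathcomp Require Import all_boot zify.

Set Implicit Arguments.
Unset Strict Implicit.
Unset Printing Implicit Defensive.

(** * Sequential transducers and their simulation by two-tape machines *)

Section Transducer.
Variables (Sigma Q : finType) (q0 : Q) (next : Q -> Sigma -> Q).
Variables (out : Q -> Sigma -> seq Sigma) (fin : Q -> option (seq Sigma)).

Fixpoint emit (q : Q) (s : seq Sigma) : seq Sigma :=
  if s is a :: s' then out q a ++ emit (next q a) s' else [::].

Lemma emit_cat q s1 s2 :
  emit q (s1 ++ s2) = emit q s1 ++ emit (foldl next q s1) s2.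
Proof. by elim: s1 q => //= a s1 IH q; rewrite IH catA. Qed.

Lemma emit_rcons q s a :
  emit q (rcons s a) = emit q s ++ out (foldl next q s) a.
Proof. by rewrite -cats1 emit_cat /= cats0. Qed.

Lemma emit_flatten (T : Type) q (F F' : T -> seq Sigma) (s : seq T) :
  (forall x, foldl next q (F x) = q /\ emit q (F x) = F' x) ->
  foldl next q (flatten (map F s)) = q /\
  emit q (flatten (map F s)) = flatten (map F' s).
Proof.
move=> FP; elim: s => //= x s [IH1 IH2]; have [F1 F2] := FP x.
by rewrite foldl_cat emit_cat F1 F2 IH1 IH2.
Qed.

(** A value of [fin] overrides the whole output; this permits a verdict that is known only after all
    of the input has been read. *)
Definition transduce (s : seq Sigma) : seq Sigma :=
  odflt (emit q0 s) (fin (foldl next q0 s)).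

Definition max_out : nat :=
  maxn (\max_(x : Q * Sigma) size (out x.1 x.2))
       (\max_(q : Q) size (odflt [::] (fin q))).

Lemma size_out q a : size (out q a) <= max_out.
Proof.
apply: leq_trans (leq_maxl _ _).
exact: (leq_bigmax (F := fun x : Q * Sigma => size (out x.1 x.2)) (q, a)).
Qed.

Lemma size_fin q w : fin q = Some w -> size w <= max_out.
Proof.
move=> finq; apply: leq_trans (leq_maxr _ _).
by apply: leq_trans (leq_bigmax q); rewrite finq.
Qed.

Lemma size_emit q s : size (emit q s) <= max_out * size s.
Proof.
elim: s q => [|a s IH] q //=.
by rewrite size_cat mulnS leq_add ?size_out ?IH.
Qed.

(** Output still to be written is kept in the finite control, so its length must be bounded; [pack]
    is faithful up to that bound. *)
Let word : finType := max_out.-bseq Sigma.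
Let pack : seq Sigma -> word := @insub_bseq max_out Sigma.

Lemma packK w : size w <= max_out -> pack w = w :> seq Sigma.
Proof. by move=> w_le; rewrite /pack /insub_bseq val_insubd w_le. Qed.

(* [inl (q, w)]: the output [w] is to be appended before reading on in state [q];
   [inr (false, w)]: the output is being erased, and [w] will be written;
   [inr (true, w)]: [w] is to be appended before halting. *)
Let tstate : finType := (Q * word + bool * word)%type.

Let tletter : Type := (Sigma + void)%type.

Let act (a b : option tletter * move) :
    {ffun 'I_2 -> option tletter * move} :=
  [ffun i => if i == ord0 then a else b].

Definition transducer_delta (x : tstate) (h : {ffun 'I_2 -> option tletter}) :
    tstate * {ffun 'I_2 -> option tletter * move} :=
  let stay0 := (h ord0, Stay) in
  let stay1 := (h ord_max, Stay) in
  match x with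
  | inl (q, w) =>
    if val w is a :: w' then
      (inl (q, pack w'), act stay0 (Some (inl a), MoveRight))
    else if h ord0 is Some (inl a) then
      (inl (next q a, pack (out q a)), act (h ord0, MoveRight) stay1)
    else if fin q is Some w' then
      (inr (false, pack w'), act stay0 (h ord_max, MoveLeft))
    else (inr (true, pack [::]), act stay0 stay1)
  | inr (false, w) =>
    if h ord_max is Some _ then (x, act stay0 (None, MoveLeft))
    else (inr (true, w), act stay0 stay1)
  | inr (true, w) =>
    if val w is a :: w' then
      (inr (true, pack w'), act stay0 (Some (inl a), MoveRight))
    else (x, act stay0 stay1)
  end.

Definition transducer : machine Sigma :=
  {| extra_tapes := 1; work := void; state := tstate;
     start := inl (q0, pack [::]);
     final := fun x => if x is inr (true, w) then nilp w else false;
     delta := transducer_delta |}.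

Let conf (x : tstate) (t0 t1 : tape tletter) : config transducer :=
  (x, [ffun i => if i == ord0 then t0 else t1]).

Let emb (s : seq Sigma) : seq (option tletter) := [seq Some (inl a) | a <- s].

Let itape l s : tape tletter := Tape l (head None (emb s)) (behead (emb s)).

(** The head is on the blank just after the written word [v]; the [j] explicit blanks are cells left
    over from erasing. *)
Let otape v j : tape tletter := Tape (rev (emb v)) None (nseq j None).

Lemma step_conf x t0 t1 x' c0 m0 c1 m1 :
  ~~ final (m := transducer) x ->
  transducer_delta x [ffun i => Defs.thead (if i == ord0 then t0 else t1)] =
    (x', act (c0, m0) (c1, m1)) ->
  step (conf x t0 t1) =
  conf x' (tape_move m0 (tape_write c0 t0)) (tape_move m1 (tape_write c1 t1)).
Proof.
move=> nfin eqd; rewrite /step -[(conf x t0 t1).1]/x (negPf nfin) /=.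
have -> : [ffun i => Defs.thead ([ffun i => if i == ord0 then t0 else t1] i)] =
          [ffun i : 'I_2 => Defs.thead (if i == ord0 then t0 else t1)].
  by apply/ffunP=> i; rewrite !ffunE.
rewrite eqd; congr (_, _); apply/ffunP=> i; rewrite !ffunE.
by case: (i == ord0).
Qed.

Lemma otape_write v j a :
  tape_move MoveRight (tape_write (Some (inl a)) (otape v j)) =
  otape (rcons v a) j.-1.
Proof. by rewrite /otape /emb map_rcons rev_rcons; case: j. Qed.

Lemma tape_stay (t : tape tletter) :
  tape_move Stay (tape_write (Defs.thead t) t) = t.
Proof. by case: t. Qed.

(** Each step writes one pending letter; [k] covers both the scanning and the final writing states.
    Writing uses up explicit blanks, whence the truncated [j - size w]. *)
Lemma flush (k : word -> tstate) w t0 v j :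
  size w <= max_out ->
  (forall a w' h, size (a :: w') <= max_out ->
     transducer_delta (k (pack (a :: w'))) h =
     (k (pack w'), act (h ord0, Stay) (Some (inl a), MoveRight)) /\
     ~~ final (m := transducer) (k (pack (a :: w')))) ->
  iter (size w) (@step _ transducer) (conf (k (pack w)) t0 (otape v j)) =
  conf (k (pack [::])) t0 (otape (v ++ w) (j - size w)).
Proof.
move=> + kP; elim: w v j => [|a w IH] v j w_le; first by rewrite cats0 subn0.
have [] := kP a w [ffun i => Defs.thead (if i == ord0 then t0 else otape v j)] w_le.
rewrite ffunE eqxx => dk nfin.
rewrite [size _]/= iterSr (step_conf nfin dk) otape_write tape_stay.
by rewrite IH ?(ltnW w_le) // cat_rcons -subn1 -subnDA.
Qed.

Lemma flush_scan q w t0 v :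
  size w <= max_out ->
  iter (size w) (@step _ transducer) (conf (inl (q, pack w)) t0 (otape v 0)) =
  conf (inl (q, pack [::])) t0 (otape (v ++ w) 0).
Proof.
move=> w_le; rewrite (flush (k := fun w => inl (q, w))) ?sub0n //.
by move=> a w' h aw_le; rewrite /= packK.
Qed.

Lemma flush_write w t0 v j :
  size w <= max_out ->
  iter (size w) (@step _ transducer)
    (conf (inr (true, pack w)) t0 (otape v j)) =
  conf (inr (true, pack [::])) t0 (otape (v ++ w) (j - size w)).
Proof.
move=> w_le; rewrite (flush (k := fun w => inr (true, w))) //.
by move=> a w' h aw_le; rewrite /= packK // /nilp packK.
Qed.

(** One step reads a letter, and at most [max_out] further steps write its output. *)
Lemma scan l q s v :
  exists2 n, n <= max_out.+1 * size s & exists l',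
    iter n (@step _ transducer) (conf (inl (q, pack [::])) (itape l s) (otape v 0)) =
    conf (inl (foldl next q s, pack [::])) (itape l' [::])
      (otape (v ++ emit q s) 0).
Proof.
elim: s l q v => [|a s IH] l q v; first by exists 0 => //; exists l; rewrite cats0.
have [n n_le [l' run]] := IH (Some (inl a) :: l) (next q a) (v ++ out q a).
exists (n + (size (out q a) + 1)).
  by rewrite mulnS addnC leq_add // addn1 ltnS size_out.
exists l'; rewrite !iterD [iter 1 _ _]/=.
rewrite (@step_conf _ _ _ (inl (next q a, pack (out q a)))
  (Some (inl a)) MoveRight None Stay) //; last first.
  by rewrite /= packK //= !ffunE.
by rewrite -[tape_move Stay _]/(otape v 0) flush_scan ?size_out //= catA.
Qed.

(** The output is a contiguous block, so the blank reached on its left marks the end of erasing;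
    noticing it costs the extra step. *)
Lemma erase w t0 v j :
  exists2 n, n <= (size v).+1 & exists j',
    iter n (@step _ transducer)
      (conf (inr (false, w)) t0 (tape_move MoveLeft (otape v j))) =
    conf (inr (true, w)) t0 (otape [::] j').
Proof.
elim/last_ind: v j => [|v a IH] j.
  exists 1 => //; exists j.+1 => /=.
  rewrite (@step_conf _ _ _ (inr (true, w)) (Defs.thead t0) Stay None Stay) ?tape_stay //.
  by rewrite /= !ffunE.
have [n n_le [j' run]] := IH j.+1.
exists n.+1; first by rewrite size_rcons.
exists j'; rewrite iterSr -run.
rewrite (@step_conf _ _ _ (inr (false, w)) (Defs.thead t0) Stay None MoveLeft)
  ?tape_stay //.
  by rewrite /otape /emb map_rcons rev_rcons.
by rewrite /= !ffunE /= /emb map_rcons rev_rcons.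
Qed.

Lemma otape_holds v j : tape_holds (M := transducer) (otape v j) v.
Proof. by exists 0, j.+1; rewrite /otape /= revK. Qed.

Lemma init_conf s :
  init transducer s = conf (inl (q0, pack [::])) (itape [::] s) (otape [::] 0).
Proof. by []. Qed.

Lemma transducer_outputs s :
  exists2 t, t <= (max_out.+1).*2 * size s + (max_out.+1).*2 &
    outputs_within transducer t s (transduce s).
Proof.
have [n n_le [l run]] := scan [::] q0 s [::].
set q := foldl next q0 s in run.
pose outputs t := outputs_within transducer t s (transduce s).
(* Half of the coefficient of [size s] pays for the scan, the other half for erasing; the constant
   term pays for writing [w] and for changes of phase. *)
suff [m m_le mP] : exists2 m, m <= max_out.+1 * size s + (max_out.+1).*2 &
    outputs (m + n).
  exists (m + n) => //; apply: leq_trans (leq_add m_le n_le) _.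
  by rewrite addnAC -mulnDl addnn.
have iter_mn m : iter (m + n) (@step _ transducer) (init transducer s) =
    iter m (@step _ transducer)
      (conf (inl (q, pack [::])) (itape l [::]) (otape (emit q0 s) 0)).
  by rewrite iterD init_conf run.
case finq: (fin q) => [w|]; last first.
  exists 1; first by rewrite doubleS addnS.
  rewrite /outputs /outputs_within /transduce -/q finq iter_mn [iter 1 _ _]/=.
  rewrite (@step_conf _ _ _ (inr (true, pack [::])) None Stay None Stay) //.
    by rewrite /= /nilp packK //=; split=> //; rewrite ffunE; apply: otape_holds.
  by rewrite /= packK //= !ffunE /= finq.
have w_le := size_fin finq.
have [m m_le [j erased]] := erase (pack w) (itape l [::]) (emit q0 s) 0.
(* One step starts the erasing, [m] steps erase and pass to the writing phase, and [size w] steps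
   write [w]. *)
exists (size w + m + 1).
  have := size_emit q0 s; lia.
rewrite /outputs /outputs_within /transduce -/q finq iter_mn !iterD [iter 1 _ _]/=.
rewrite (@step_conf _ _ _ (inr (false, pack w)) None Stay None MoveLeft) //; last first.
  by rewrite /= packK //= !ffunE /= finq.
rewrite -[tape_move Stay _]/(itape l [::]) erased flush_write // cat0s.
by rewrite /= /nilp packK //; split=> //; rewrite ffunE; apply: otape_holds.
Qed.
Theorem transducer_poly_time (X Y : Type) (codeX : X -> seq Sigma)
    (codeY : Y -> seq Sigma) (f : X -> Y) :
  (forall x, codeY (f x) = transduce (codeX x)) -> poly_time codeX codeY f.
Proof.
move=> fE; exists transducer, (max_out.+1).*2, 1 => x.
by rewrite expn1 fE; apply: transducer_outputs.
Qed.

End Transducer.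

(** A one-state transducer emits two letters for each one read. Doubling is the parameter bound used
    in all reductions. *)
Lemma computable_double : computable double.
Proof.
pose out (_ : unit) (_ : unit) := [:: tt; tt].
exists (transducer tt (fun q _ => q) out (fun _ => None)) => n.
have [t _] := transducer_outputs tt (fun q _ => q) out (fun _ => None) (nseq n tt).
suff -> : transduce tt (fun q _ => q) out (fun _ => None) (nseq n tt) =
          nseq n.*2 tt by exists t.
by rewrite /transduce /=; elim: n => //= n ->.
Qed.

(** * Transducers acting on encoded instances *)

Section TransduceCodes.
Variables (Q : finType) (next : Q -> sym -> Q) (out : Q -> sym -> seq sym).

Lemma emit_ones q n :
  next q (Bit true) = q -> out q (Bit true) = [:: Bit true] ->
  foldl next q (nseq n (Bit true)) = q /\
  emit next out q (nseq n (Bit true)) = nseq n (Bit true).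
Proof. by move=> nq oq; elim: n => //= n [IH1 IH2]; rewrite nq oq IH1 IH2. Qed.

(** The closing [Semi], on which the transducers pass to the next block, is split off. *)
Definition code_rows (m n : nat) (e : 'I_m -> 'I_n -> seq bool) : seq sym :=
  flatten [seq rcons (flatten [seq map Bit (e i j) | j <- enum 'I_n]) Comma
          | i <- enum 'I_m].

Lemma code_matrixE m n (e : 'I_m -> 'I_n -> seq bool) :
  code_matrix e = rcons (code_rows e) Semi.
Proof. by []. Qed.

(** The state recurs after every entry and every [Comma], so the rows are translated entry by
    entry. *)
Lemma emit_rows m n (e e' : 'I_m -> 'I_n -> seq bool) q :
  next q Comma = q -> out q Comma = [:: Comma] ->
  (forall i j, foldl next q (map Bit (e i j)) = q /\
               emit next out q (map Bit (e i j)) = map Bit (e' i j)) ->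
  foldl next q (code_rows e) = q /\
  emit next out q (code_rows e) = code_rows e'.
Proof.
move=> nq oq eP; apply: emit_flatten => i.
have [F1 F2] := emit_flatten (enum 'I_n) (eP i).
by rewrite foldl_rcons emit_rcons F1 F2 nq oq cats1.
Qed.

Lemma foldl_block q q' w w' s :
  foldl next q w = q' /\ emit next out q w = w' ->
  foldl next q (rcons w Semi ++ s) = foldl next (next q' Semi) s.
Proof. by case=> <- _; rewrite -cats1 -catA foldl_cat. Qed.

Lemma emit_block q q' w w' s :
  foldl next q w = q' /\ emit next out q w = w' ->
  emit next out q (rcons w Semi ++ s) =
    w' ++ out q' Semi ++ emit next out (next q' Semi) s.
Proof. by case=> <- <-; rewrite -cats1 -catA emit_cat. Qed.

Lemma eq_code_rows m n (e e' : 'I_m -> 'I_n -> seq bool) :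
  (forall i j, e i j = e' i j) -> code_rows e = code_rows e'.
Proof.
move=> ee'; rewrite /code_rows; congr flatten; apply: eq_map => i.
by congr (rcons (flatten _) _); apply: eq_map => j; rewrite ee'.
Qed.

End TransduceCodes.

(** * Plans and relations with one user per resource *)

Section SingletonRelation.
Variables (U R : finType) (Abse : {set U * R}) (C : {set constr R}).
Variables (auth : {set R * U}) (C' : {set R * R * wsp_type}).
Hypothesis auth_base : forall r u, ((r, u) \in auth) = ((u, r) \in Abse).
Hypothesis card_one : CardOne \in C.
Hypothesis eq_bind : forall r r', ((r, r', StepEq) \in C') =
  (PairConstr r r' Bind Ex \in C) || (PairConstr r r' Bind All \in C).
Hypothesis neq_separate : forall r r', ((r, r', StepNeq) \in C') =
  (PairConstr r r' Separate Ex \in C) || (PairConstr r r' Separate All \in C).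

Definition step_type (l : link) : wsp_type :=
  if l is Bind then StepEq else StepNeq.

(** Two singletons either coincide or are disjoint, so the quantifier [k] makes no difference. *)
Lemma satisfies_singletons (A : {set U * R}) (p : {ffun R -> U}) r r' l k :
  (forall r, users A r = [set p r]) ->
  satisfies A (PairConstr r r' l k) <-> plan_satisfies p (r, r', step_type l).
Proof.
move=> Ap; have I1 : ([set p r] :&: [set p r'] == set0) = (p r != p r').
  by rewrite setI_eq0 disjoints1 inE.
have E1 : [set p r] = [set p r'] <-> p r = p r' by split=> [/set1_inj|->].
case: l k => [] [] /=; rewrite !Ap ?I1 ?negbK.
- by split=> /eqP.
- exact: E1.
- by split=> nE E; apply: nE; apply/E1.
- by split=> [/eqP | nE]; [rewrite I1 => /eqP | apply/eqP; rewrite I1; apply/eqP].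
Qed.

Lemma in_step_type r r' l k :
  PairConstr r r' l k \in C -> (r, r', step_type l) \in C'.
Proof. by case: l k => [] [] /= cC; rewrite (eq_bind, neq_separate) cC ?orbT. Qed.

Lemma step_type_in r r' t :
  (r, r', t) \in C' -> exists2 c, c \in C &
    exists l k, c = PairConstr r r' l k /\ step_type l = t.
Proof.
by case: t; rewrite (eq_bind, neq_separate) => /orP[] cC;
  (eexists; first exact: cC); do 2!eexists.
Qed.

Lemma valid_singletons (A : {set U * R}) (p : {ffun R -> U}) :
  (forall r, users A r = [set p r]) ->
  valid Abse C A <-> valid_plan auth C' p.
Proof.
move=> Ap; have inA u r : ((u, r) \in A) = (u == p r).
  by have := in_set1 u (p r); rewrite -Ap inE.
split=> [[/subsetP Asub _ elig]|[auth_p C'_p]].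
  split=> [r|[[r r'] t] /step_type_in[c cC [l [k [cE tE]]]]].
    by rewrite auth_base; apply: Asub; rewrite inA.
  by rewrite -tE; apply/(satisfies_singletons _ _ _ k Ap); rewrite -cE; apply: elig.
split.
- by apply/subsetP=> -[u r]; rewrite inA -auth_base => /eqP->.
- by move=> r; rewrite Ap -card_gt0 cards1.
- case=> [r r' l k|] cC; last by move=> r; rewrite Ap cards1.
  by apply/(satisfies_singletons _ _ _ _ Ap); apply/C'_p/(in_step_type cC).
Qed.

(** Under [CardOne] each [users A r] is a singleton, and these define a plan; conversely, the graph
    of a plan is such a relation. The hypotheses on [C] and [C'] are loose enough to serve both
    reductions. *)
Lemma valid_iff_plan :
  (exists A, valid Abse C A) <-> (exists p, valid_plan auth C' p).
Proof.
split=> [[A validA]|[p validp]].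
  have [_ _ /(_ _ card_one) A1] := validA.
  have /fin_all_exists[p Ap] r : exists u, users A r = [set u].
    by apply/cards1P; rewrite A1.
  have Ap' r : users A r = [set finfun p r] by rewrite ffunE Ap.
  by exists (finfun p); apply/(valid_singletons Ap').
pose A := [set ur : U * R | ur.1 == p ur.2].
have Ap r : users A r = [set p r] by apply/setP=> u; rewrite !inE.
by exists A; apply/(valid_singletons Ap).
Qed.

End SingletonRelation.

(** * The translation from D-APEP to WSP *)

Section DapepToWsp.

(** The quantifier [k] is forgotten, so two constraints on a pair may merge into one. *)
Definition wsp_of (I : dapep_inst) : wsp_inst :=
  let C := constraints I in
  @WspInst (nusers I) (nresources I) [set ru | (ru.2, ru.1) \in base I]
    [set c | [exists k, PairConstr c.1.1 c.1.2
                (if c.2 is StepEq then Bind else Separate) k \in C]].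

Lemma exists_quant (P : pred quant) : [exists k, P k] = P Ex || P All.
Proof.
apply/existsP/orP=> [[[] Pk]|[] Pk]; by [left|right|exists Ex|exists All].
Qed.

Lemma wsp_of_positive (I : dapep_inst) :
  CardOne \in constraints I ->
  positive (p := DAPEP) I <-> positive (p := WSP) (wsp_of I).
Proof.
move=> one; apply: valid_iff_plan => //= *; rewrite inE //=; exact: exists_quant.
Qed.

(* The component of type ['I_5] counts the occurrences of [Semi] read so far;
   in the matrix of constraints, the second component stores the first one of
   the two bits for a pair of resources and an arrow. *)
Let Q : finType := ('I_5 * option bool)%type.

Let next (q : Q) (a : sym) : Q :=
  match a with
  | Bit b => if val q.1 == 3 then (q.1, if q.2 is None then Some b else None)
             else q
  | Comma => q
  | Semi => (ordS q.1, None)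
  end.

Let out (q : Q) (a : sym) : seq sym :=
  match val q.1, a with
  | 4, _ => [::]
  | 3, Bit b => if q.2 is Some b' then [:: Bit (b' || b)] else [::]
  | _, _ => [:: a]
  end.

Lemma wsp_of_code (I : dapep_inst) :
  wsp_code (wsp_of I) =
  transduce (ord0, None) next out (fun _ => None) (dapep_code I).
Proof.
have bits_copy k b : val k != 3 -> val k != 4 ->
    foldl next (k, None) (map Bit [:: b]) = (k, None) /\
    emit next out (k, None) (map Bit [:: b]) = map Bit [:: b].
  by case: k => -[|[|[|[|[]]]]].
(* In the matrix of constraints, the bits for [Ex] and [All] are merged by disjunction. *)
have bits_or k b1 b2 b3 b4 : val k = 3 ->
    foldl next (k, None) (map Bit [:: b1; b2; b3; b4]) = (k, None) /\
    emit next out (k, None) (map Bit [:: b1; b2; b3; b4]) =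
    map Bit [:: b1 || b2; b3 || b4].
  by case: k => -[|[|[|[|[|]]]]].
rewrite /transduce /= /dapep_code /wsp_code /code_nat !code_matrixE.
pose q0 : Q := (ord0, None); pose q1 := next q0 Semi.
pose q2 := next q1 Semi; pose q3 := next q2 Semi.
rewrite (emit_block _ (@emit_ones _ next out q0 _ erefl erefl)).
rewrite (emit_block _ (@emit_ones _ next out q1 _ erefl erefl)).
rewrite (emit_block _ (@emit_rows _ next out _ _ _ _ q2 erefl erefl
  (fun r u => bits_copy q2.1 _ isT isT))).
rewrite (emit_block _ (@emit_rows _ next out _ _ _ _ q3 erefl erefl
  (fun r r' => bits_or q3.1 _ _ _ _ erefl))).
rewrite (@eq_code_rows _ _ _ (fun r u => [:: (u, r) \in base I])); last first.
  by move=> r u; rewrite inE.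
rewrite (@eq_code_rows (wsp_nsteps (wsp_of I)) _ _ (fun r r' =>
  let C := constraints I in
  [:: (PairConstr r r' Bind Ex \in C) || (PairConstr r r' Bind All \in C);
      (PairConstr r r' Separate Ex \in C) ||
      (PairConstr r r' Separate All \in C)])); last first.
  by move=> r r'; rewrite !inE /= !exists_quant.
(* The last bit, for [CardOne], is read when the counter is 4, where nothing is emitted. *)
by rewrite -!cats1 -!catA.
Qed.
End DapepToWsp.

(** * The translation from WSP to D-APEP *)

Section WspToDapep.
Variable t : wsp_type.

(** Unsatisfiable over the diagonal base relation: either two resources with different sole users
    must share one, or a resource must differ from itself. The choice by [t] keeps the constraint
    within an allowed family. *)
Definition conflict : constr 'I_2 :=
  if t is StepEq then PairConstr ord0 ord_max Bind Ex
  else PairConstr ord0 ord0 Separate Ex.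

Lemma diag_complete (n : nat) (r : 'I_n) :
  users [set ur : 'I_n * 'I_n | ur.1 == ur.2] r != set0.
Proof. by apply/set0Pn; exists r; rewrite !inE. Qed.

Definition negative_dapep : dapep_inst :=
  DapepInst (@diag_complete 2) [set CardOne; conflict].

Lemma negative_dapepP : ~ positive (p := DAPEP) negative_dapep.
Proof.
case=> A [/subsetP Asub _ /(_ conflict)]; rewrite !inE eqxx orbT => /(_ isT).
rewrite /conflict; case: t => //= /set0Pn[u]; rewrite !inE.
by case/andP=> /Asub + /Asub; rewrite !inE /= => /eqP->.
Qed.

Definition authorizable (J : wsp_inst) : bool :=
  [forall s, [exists u, (s, u) \in wsp_auth J]].

Definition base_of (J : wsp_inst) :
    {set 'I_(wsp_nusers J) * 'I_(wsp_nsteps J)} :=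
  [set ur | (ur.2, ur.1) \in wsp_auth J].

Lemma base_of_complete J : authorizable J -> forall r, users (base_of J) r != set0.
Proof.
by move=> /forallP aJ r; have /existsP[u] := aJ r; move=> ru;
  apply/set0Pn; exists u; rewrite !inE.
Qed.

(** [Ex] alone suffices, as [CardOne] makes both quantifiers equivalent; the bits for [All] become
    constant padding. *)
Definition constraints_of (J : wsp_inst) : {set constr 'I_(wsp_nsteps J)} :=
  [set c | match c with
           | PairConstr r r' l Ex => (r, r', step_type l) \in wsp_constraints J
           | PairConstr _ _ _ All => false
           | CardOne => true
           end].

(** Matching on [idP] supplies the proof of [authorizable J] from which the field [base_complete] is
    built. *)
Definition dapep_of (J : wsp_inst) : dapep_inst :=
  match @idP (authorizable J) with
  | ReflectT aJ => DapepInst (base_of_complete aJ) (constraints_of J)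
  | ReflectF _ => negative_dapep
  end.

Lemma dapep_of_positive (J : wsp_inst) :
  positive (p := WSP) J <-> positive (p := DAPEP) (dapep_of J).
Proof.
rewrite /dapep_of; case: {-}_ / idP => [aJ|naJ].
  apply: iff_sym; apply: valid_iff_plan => //= *; by rewrite !inE ?orbF.
split=> [[p [auth_p _]]|/negative_dapepP//]; case: naJ.
by apply/forallP=> s; apply/existsP; exists (p s).
Qed.

Lemma dapep_of_param (J : wsp_inst) : nresources (dapep_of J) <= (wsp_nsteps J).*2.
Proof.
rewrite /dapep_of; case: {-}_ / idP => [aJ|naJ] /=; first by rewrite -addnn leq_addr.
(* Without steps [authorizable J] would hold vacuously; so there is a step, and two resources are
   within the bound. *)
rewrite (leq_double 1) lt0n; apply/negP=> /eqP steps0; case: naJ.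
by apply/forallP=> s; have := ltn_ord s; rewrite {2}steps0.
Qed.

(* The components are the number of occurrences of [Semi] read so far, whether
   the current row of the authorization matrix has an entry [true], and whether
   some earlier row has none. *)
Let Q : finType := ('I_4 * bool * bool)%type.

Let next (q : Q) (a : sym) : Q :=
  let: (k, seen, bad) := q in
  match a with
  | Bit b => if val k == 2 then (k, seen || b, bad) else q
  | Comma => if val k == 2 then (k, false, bad || ~~ seen) else q
  | Semi => (ordS k, false, bad)
  end.

Let out (q : Q) (a : sym) : seq sym :=
  match val q.1.1, a with
  | 3, Bit b => [:: Bit b; Bit false]
  | 3, Semi => [:: Semi; Bit true]
  | _, _ => [:: a]
  end.

Let fin (q : Q) : option (seq sym) :=
  if q.2 then Some (dapep_code negative_dapep) else None.

Lemma emit_auth_row (T : Type) (f : pred T) (s : seq T) (k : 'I_4) seen bad :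
  val k = 2 ->
  let row := flatten [seq map Bit [:: f j] | j <- s] in
  foldl next (k, seen, bad) row = (k, seen || has f s, bad) /\
  emit next out (k, seen, bad) row = row.
Proof.
move=> k2; elim: s seen => [|j s IH] seen /=; first by rewrite orbF.
by rewrite k2 /= (IH _).1 (IH _).2 /out /= k2 orbA.
Qed.

(** Each [Comma] adds to the flag whether the row just ended had no entry [true], and resets the
    record for the next row. *)
Lemma emit_auth (m n : nat) (f : 'I_m -> 'I_n -> bool) (k : 'I_4) bad :
  val k = 2 ->
  let rows := code_rows (fun i j => [:: f i j]) in
  foldl next (k, false, bad) rows =
    (k, false, bad || ~~ [forall i, exists j, f i j]) /\
  emit next out (k, false, bad) rows = rows.
Proof.
move=> k2; rewrite /code_rows /=.
(* As [has] over enumerations, the condition follows the order of reading and admits induction on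
   the rows. *)
have -> : ~~ [forall i, exists j, f i j] =
    has (fun i => ~~ has (f i) (enum 'I_n)) (enum 'I_m).
  rewrite negb_forall; apply/existsP/hasP => [[i fi]|[i _ fi]]; exists i.
  - exact: mem_enum.
  - by apply: contra fi => /hasP[j _ fij]; apply/existsP; exists j.
  - by apply: contra fi => /existsP[j fij]; apply/hasP; exists j; rewrite ?mem_enum.
elim: (enum 'I_m) bad => [|i s IH] bad /=; first by rewrite orbF.
have [F1 F2] := emit_auth_row (f i) (enum 'I_n) false bad k2.
rewrite foldl_cat emit_cat foldl_rcons emit_rcons F1 F2 /= /out /= k2 /=.
by rewrite (IH _).1 (IH _).2 orbA cats1.
Qed.

Lemma dapep_of_code (J : wsp_inst) :
  dapep_code (dapep_of J) = transduce (ord0, false, false) next out fin (wsp_code J).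
Proof.
have ones_copy k bad n : val k != 2 -> val k != 3 ->
    foldl next (k, false, bad) (nseq n (Bit true)) = (k, false, bad) /\
    emit next out (k, false, bad) (nseq n (Bit true)) = nseq n (Bit true).
  by case: k => -[|[|[|[|]]]] // *; apply: emit_ones.
(* A [false] for [All] is inserted after each bit. *)
have bits_pad (k : 'I_4) b b' bad : val k = 3 ->
    foldl next (k, false, bad) (map Bit [:: b; b']) = (k, false, bad) /\
    emit next out (k, false, bad) (map Bit [:: b; b']) =
    map Bit [:: b; false; b'; false].
  by case: k => -[|[|[|[|]]]].
have rows_copy := emit_auth (fun s u => (s, u) \in wsp_auth J)
  (k := ordS (ordS ord0)) false erefl.
have rows_pad bad := @emit_rows _ next out _ _
  (fun s s' => [:: (s, s', StepEq) \in wsp_constraints J;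
                   (s, s', StepNeq) \in wsp_constraints J])
  _ (ordS (ordS (ordS ord0)), false, bad) erefl erefl
  (fun s s' => bits_pad (ordS (ordS (ordS ord0))) _ _ bad erefl).
rewrite /transduce /wsp_code /code_nat !code_matrixE.
pose q0 : Q := (ord0, false, false); pose q1 := next q0 Semi.
rewrite !(foldl_block _ (ones_copy q0.1.1 q0.2 _ isT isT)).
rewrite !(foldl_block _ (ones_copy q1.1.1 q1.2 _ isT isT)).
rewrite (foldl_block _ rows_copy) foldl_rcons (rows_pad _).1.
rewrite (emit_block _ (ones_copy q0.1.1 q0.2 _ isT isT)).
rewrite (emit_block _ (ones_copy q1.1.1 q1.2 _ isT isT)).
rewrite (emit_block _ rows_copy) emit_rcons (rows_pad _).1 (rows_pad _).2.
(* The flag reached is the negation of [authorizable J], so [fin] distinguishes the same two cases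
   as [dapep_of]. *)
rewrite /fin /= -/(authorizable J) /dapep_of; case: {-}_ / idP => [aJ|naJ]; last first.
  by case: (authorizable J) naJ.
(* Naming the transduced word [w] shields it from the rewriting of rows below. *)
rewrite aJ /dapep_code !code_matrixE; set w := (X in _ = X).
rewrite (@eq_code_rows (wsp_nsteps J) (wsp_nusers J) _
  (fun s u => [:: (s, u) \in wsp_auth J])); last first.
  by move=> s u; rewrite inE.
rewrite (@eq_code_rows (wsp_nsteps J) (wsp_nsteps J) _ (fun s s' =>
  [:: (s, s', StepEq) \in wsp_constraints J; false;
      (s, s', StepNeq) \in wsp_constraints J; false])); last first.
  by move=> s s'; rewrite !inE.
(* The [Bit true] emitted after the last [Semi] records the presence of [CardOne]. *)
by rewrite inE /w /code_nat -!cats1 -!catA.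
Qed.
End WspToDapep.

(** * Both reductions for an arbitrary list of constraint types *)

Definition wsp_family (t : wsp_type) : Defs.family := if t is StepEq then BoD else SoD.

Lemma in_wsp_family l k (R : Type) (r r' : R) t :
  in_family (PairConstr r r' l k) (wsp_family t) = (step_type l == t).
Proof. by case: l t => [] []. Qed.

Lemma has_in_family (R : Type) (r r' : R) l k (ts : seq wsp_type) :
  has (in_family (PairConstr r r' l k)) (map wsp_family ts) = (step_type l \in ts).
Proof.
rewrite has_map -has_pred1; apply: eq_has => t /=.
by rewrite in_wsp_family eq_sym.
Qed.

Lemma dapep_le_wsp (ts : seq wsp_type) :
  fpt_le (DAPEP_one (map wsp_family ts)) (WSP_only ts).
Proof.
have only (I : inst (DAPEP_one (map wsp_family ts))) :
    forall c, c \in wsp_constraints (wsp_of (sval I)) -> c.2 \in ts.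
  case: I => I /= [_ fam] c; rewrite inE => /existsP[k /fam[//|]].
  by rewrite has_in_family; case: c.2.
exists (fun I => exist _ (wsp_of (sval I)) (only I)); split.
- by apply: transducer_poly_time => I /=; apply: wsp_of_code.
- by move=> [I D]; apply: wsp_of_positive; case: D.
- by exists double; [exact: computable_double | move=> I /=; rewrite -addnn leq_addr].
Qed.

(** The type [t] is one allowed by [ts], so the fixed negative instance built from it stays within
    the permitted families. *)
Lemma wsp_le_dapep (ts : seq wsp_type) t :
  t \in ts -> fpt_le (WSP_only ts) (DAPEP_one (map wsp_family ts)).
Proof.
move=> t_ts.
have fam (J : inst (WSP_only ts)) : let C := constraints (dapep_of t (sval J)) in
    CardOne \in C /\
    forall c, c \in C -> c = CardOne \/ has (in_family c) (map wsp_family ts).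
  case: J => J only; rewrite /dapep_of /=; case: {-}_ / idP => [aJ|naJ] /=.
    split=> [|[r r' l k|]]; rewrite inE; [by []| |by left].
    by case: k => // /only; right; rewrite has_in_family.
  split=> [|c]; rewrite !inE ?eqxx // => /orP[]/eqP->; [by left|right].
  by case: t t_ts => t_ts; rewrite /conflict has_in_family.
exists (fun J => exist _ (dapep_of t (sval J)) (fam J)); split.
- by apply: transducer_poly_time => J /=; apply: dapep_of_code.
- by move=> J; apply: dapep_of_positive.
- by exists double; [exact: computable_double | move=> J; apply: dapep_of_param].
Qed.

Theorem theorem4 :
  [/\ fpt_eq (DAPEP_one [:: SoD]) (WSP_only [:: StepNeq]),
      fpt_eq (DAPEP_one [:: BoD]) (WSP_only [:: StepEq]) &
      fpt_eq (DAPEP_one [:: BoD; SoD]) (WSP_only [:: StepEq; StepNeq])].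
Proof.
have eq_fam ts t : t \in ts -> fpt_eq (DAPEP_one (map wsp_family ts)) (WSP_only ts).
  by move=> t_ts; split; [exact: dapep_le_wsp | exact: wsp_le_dapep t_ts].
split.
- exact: (eq_fam [:: StepNeq] StepNeq).
- exact: (eq_fam [:: StepEq] StepEq).
(* Either type could provide the conflict here. *)
- exact: (eq_fam [:: StepEq; StepNeq] StepEq).
Qed.
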